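(* Let $X$ be a compact graph-like space with at least one edge. Then $X$ is topologically reconstructible; that is, every topological space $Y$ with $\mathcal{D}(Y)=\mathcal{D}(X)$ is homeomorphic to $X$.
   Context: A graph-like space is a metrizable space $X$ together with a zero-dimensional subspace $V\subset X$ (the vertices) such that every connected component of $X\setminus V$ (these components are called the edges) is an open subset of $X$ homeomorphic to the open unit interval $(0,1)$ and its boundary in $X$ consists of only one or two points. Zero-dimensional means having a base of clopen sets. For a topological space $X$, the deck is $\mathcal{D}(X)=\{[X\setminus\{x\}] : x\in X\}$, where $[Z]$ denotes the homeomorphism class of $Z$ and $X \setminus \{x\}$ carries the subspace topology (the deck is a set, without multiplicities). $X$ is topologically reconstructible if $\mathcal{D}(X)=\mathcal{D}(Y)$ implies $X\cong Y$ for every topological space $Y$. Standing convention: all spaces considered have at least three points. *)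

(* Defs.v *)
From HB Require Import structures.
From mathcomp Require Import all_boot all_order all_algebra.
From mathcomp Require Import all_classical all_reals all_analysis.

Set Implicit Arguments.
Unset Strict Implicit.
Unset Printing Implicit Defensive.

Import Order.TTheory GRing.Theory Num.Theory.
Import numFieldNormedType.Exports.

Local Open Scope classical_set_scope.
Local Open Scope ring_scope.

Definition homeomorphic (X Y : topologicalType) : Prop :=
  exists (f : X -> Y) (g : Y -> X),
    [/\ cancel f g, cancel g f, continuous f & continuous g].

(* A subset [A : set X], used as a space, is [set_type A] with the topology
   induced by the inclusion into [X]. *)

(* Homeomorphism classes and decks are plain predicates rather than
   [set topologicalType], which would force the universe of [set] strictly
   above that of [topologicalType]. *)
Definition homeo_class (Z : topologicalType) : topologicalType -> Prop :=
  fun W => homeomorphic Z W.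

Definition deck (X : topologicalType) : (topologicalType -> Prop) -> Prop :=
  fun C => exists x : X, C = homeo_class (set_type (~` [set x])).

Definition reconstructible (X : topologicalType) : Prop :=
  forall Y : topologicalType, deck Y = deck X -> homeomorphic Y X.

Definition metrizable (R : realType) (X : topologicalType) : Prop :=
  exists M : metricType R, homeomorphic X M.

(* Not the library's [zero_dimensional], which only asks for distinct points
   to be separated by a clopen set. *)
Definition has_clopen_base (T : topologicalType) : Prop :=
  exists2 B : set (set T), B `<=` clopen & basis B.

Definition boundary (X : topologicalType) (A : set X) : set X :=
  closure A `\` interior A.

Definition edges (X : topologicalType) (V : set X) : set (set X) :=
  [set connected_component (~` V) x | x in ~` V].

(* In the last clause [a = b] is allowed, so that the boundary consists of
   exactly one or exactly two points. *)
Definition graph_like (R : realType) (X : topologicalType) (V : set X) : Prop :=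
  [/\ metrizable R X,
      has_clopen_base (set_type V) &
      forall e : set X, edges V e ->
        [/\ open e,
            homeomorphic (set_type e) (set_type (`]0, 1[ : set R)) &
            exists a b : X, boundary e = [set a; b]]].

(* Main.v *)
(** Call the number of pieces into which arbitrarily small punctured neighborhoods
of a point can be cut the number of local ends at that point.  Let [Y] have the
deck of the compact Hausdorff space [X].  Then [Y] is Hausdorff and locally
compact, and if [Y] is compact, then [X] and [Y] are both the compact Hausdorff
extension by one point of a common card.

Suppose that [Y] is not compact.  Then [Y] has no isolated point, because
otherwise some card of [X] would be compact.  If [X \ x] is homeomorphic to
[Y \ y], then [x] has one more local end than [y], namely the end of [Y] at
infinity.  So every point of [X] has at least two local ends.  A point [x0] of
an edge has at most two, so the point [y0] of [Y] whose card is [X \ x0] has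
only one.  But [y0] survives in any other card of [Y], which is a card of [X],
and local ends do not change in open subspaces: a contradiction. *)

Require Import Defs.
From mathcomp Require Import all_boot all_order all_algebra.
From mathcomp Require Import all_classical all_reals all_analysis.

Set Implicit Arguments.
Unset Strict Implicit.
Unset Printing Implicit Defensive.

Import Order.TTheory GRing.Theory Num.Theory.
Import numFieldNormedType.Exports.

Local Open Scope classical_set_scope.
Local Open Scope card_scope.

(** * Homeomorphisms between subspaces and transport of local ends *)

(* A homeomorphism between the subspaces [A] and [B] as a pair of total
   functions, whose values outside [A] and [B] are irrelevant. *)
Definition rel_homeo (S T : topologicalType) (A : set S) (B : set T)
    (f : S -> T) (g : T -> S) : Prop :=
  [/\ forall a, A a -> B (f a) /\ g (f a) = a,
      forall b, B b -> A (g b) /\ f (g b) = b,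
      forall O, open O -> exists2 W, open W & forall a, A a -> W a <-> O (f a) &
      forall O, open O -> exists2 W, open W & forall b, B b -> W b <-> O (g b)].

(* The point [x] has at least [I] local ends. *)
Definition splits (I : Type) (T : topologicalType) (x : T) : Prop :=
  exists A : I -> set T,
    [/\ forall i, open (A i),
        forall i, ~ A i x,
        forall i j a, A i a -> A j a -> i = j,
        forall i, closure (A i) x &
        nbhs x [set a | a = x \/ exists i, A i a]].

Lemma homeomorphic_sym (S T : topologicalType) :
  homeomorphic S T -> homeomorphic T S.
Proof. by move=> [f [g [fK gK cf cg]]]; exists g, f; split. Qed.

Lemma homeomorphic_refl (S : topologicalType) : homeomorphic S S.
Proof. by exists id, id; split => // x; exact: cvg_id. Qed.

Lemma homeomorphic_hausdorff (S T : topologicalType) :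
  homeomorphic S T -> hausdorff_space T -> hausdorff_space S.
Proof.
move=> [f [g [fK gK cf cg]]] hT x y clxy.
apply: (can_inj fK); apply: hT => P Q Pfx Qfy.
have [z [Pz Qz]] := clxy _ _ (cf _ _ Pfx) (cf _ _ Qfy).
by exists (f z).
Qed.

Lemma rel_homeo_sym (S T : topologicalType) (A : set S) (B : set T) f g :
  rel_homeo A B f g -> rel_homeo B A g f.
Proof. by case=> *; split. Qed.

(** The default values [t] and [s] matter for cards: when [s] and [t] are the removed points, [f]
    and [g] exchange them. *)
Lemma homeomorphic_rel (S T : topologicalType) (A : set S) (B : set T)
    (s : S) (t : T) :
  homeomorphic (set_type A) (set_type B) ->
  exists f g, [/\ rel_homeo A B f g, forall a, ~ A a -> f a = t &
                  forall b, ~ B b -> g b = s].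
Proof.
move=> [h [k [hK kK ch ck]]].
pose f a := if insub a is Some u then set_val (h u) else t.
pose g b := if insub b is Some u then set_val (k u) else s.
have fE (u : set_type A) : f (set_val u) = set_val (h u) by rewrite /f valK.
have gE (u : set_type B) : g (set_val u) = set_val (k u) by rewrite /g valK.
have inA a : A a -> exists u : set_type A, a = set_val u.
  by move=> /mem_set aA; exists (SigSub aA).
have inB b : B b -> exists u : set_type B, b = set_val u.
  by move=> /mem_set bB; exists (SigSub bB).
exists f, g; split; last 2 first.
- by move=> a nA; rewrite /f insubF//; apply/negbTE/negP => /set_mem.
- by move=> a nA; rewrite /g insubF//; apply/negbTE/negP => /set_mem.
split.
- move=> _ /inA[u ->]; rewrite fE; split; last by rewrite gE hK.
  exact: set_mem (valP (h u)).
- move=> _ /inB[u ->]; rewrite gE; split; last by rewrite fE kK.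
  exact: set_mem (valP (k u)).
- move=> O oO; have oh : open (h @^-1` (set_val @^-1` O)).
    by apply: open_comp => [u _|]; [exact: ch | exists O].
  case: oh => W oW WE; exists W => // _ /inA[u ->]; rewrite fE.
  by change ((set_val @^-1` W) u <-> O (set_val (h u))); rewrite WE.
- move=> O oO; have oh : open (k @^-1` (set_val @^-1` O)).
    by apply: open_comp => [u _|]; [exact: ck | exists O].
  case: oh => W oW WE; exists W => // _ /inB[u ->]; rewrite gE.
  by change ((set_val @^-1` W) u <-> O (set_val (k u))); rewrite WE.
Qed.

Lemma rel_homeo_continuous (S T : topologicalType) (A : set S) (B : set T) f g :
  open A -> rel_homeo A B f g -> forall a, A a -> {for a, continuous f}.
Proof.
move=> oA [_ _ cf _] a Aa N; rewrite nbhsE => -[U [oU Ufa] UN].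
have [W oW WU] := cf _ oU.
rewrite nbhsE; exists (W `&` A).
  by split; [exact: openI | split => //; apply/WU].
by move=> c [Wc Ac]; apply: UN; apply/WU.
Qed.

Lemma rel_homeo_open (S T : topologicalType) (A : set S) (B : set T) f g O :
  open A -> rel_homeo A B f g -> open O -> open (A `&` f @^-1` O).
Proof.
move=> oA [_ _ cf _] /cf[W oW WO].
rewrite (_ : _ `&` _ = A `&` W); first exact: openI.
by apply/seteqP; split => a /= [Aa ?]; split => //; apply/WO.
Qed.

Lemma rel_homeo_compact (S T : topologicalType) (A : set S) (B : set T) f g K :
  open A -> rel_homeo A B f g -> compact K -> K `<=` A -> compact (f @` K).
Proof.
move=> oA fg cK KA; apply: continuous_compact => //.
apply: continuous_in_subspaceT => a /set_mem/KA.
exact: (rel_homeo_continuous oA fg).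
Qed.

(** Local ends are a local invariant: as [A] and [B] are open, pulling the pieces back along [g]
    keeps them open in the ambient space. *)
Lemma rel_homeo_splits (I : Type) (S T : topologicalType) (A : set S)
    (B : set T) f g a :
  open A -> open B -> rel_homeo A B f g -> A a ->
  splits I a -> splits I (f a).
Proof.
move=> oA oB fg Aa [C [oC nC dC clC NC]].
have gf := rel_homeo_sym fg.
have [fK gK _ _] := fg.
have [Bfa gfa] := fK _ Aa.
exists (fun i => B `&` g @^-1` (C i)); split.
- by move=> i; exact: (rel_homeo_open oB gf).
- by move=> i [_]; rewrite /= gfa; exact: nC.
- by move=> i j b [_ bi] [_ bj]; exact: dC bi bj.
- move=> i N Nfa.
  have [|c [Cc [Ac Nc]]] := clC i (A `&` f @^-1` N).
    apply: filterI; first exact: open_nbhs_nbhs.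
    exact: (rel_homeo_continuous oA fg Aa).
  have [Bfc gfc] := fK _ Ac.
  by exists (f c); split => //; split => //=; rewrite gfc.
- have := rel_homeo_continuous oB gf Bfa; rewrite /prop_for /continuous_at gfa.
  move=> /(_ _ NC) Ng.
  have nB : nbhs (f a) B by exact: open_nbhs_nbhs.
  apply: (@filterS _ (nbhs (f a)) _
    (g @^-1` [set c | c = a \/ exists i, C i c] `&` B)); last exact: filterI.
  move=> b /= [+ Bb]; case=> [gba|[i Ci]]; last by right; exists i.
  by left; rewrite -gba; have [] := gK _ Bb.
Qed.

(** * Local ends on the real line *)

(** The trace on [C] of a piece that meets [C] is clopen in [C], because the other pieces have an
    open union. *)
Lemma connected_sub_piece (I : Type) (T : topologicalType) (A : I -> set T)
    (C : set T) :
  (forall i, open (A i)) -> (forall i j a, A i a -> A j a -> i = j) ->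
  connected C -> C !=set0 -> (forall a, C a -> exists i, A i a) ->
  exists i, C `<=` A i.
Proof.
move=> oA dA cC [c Cc] CA; have [i Aic] := CA _ Cc; exists i.
have <- : C `&` A i = C; last by move=> a [].
apply: cC; first by exists c.
  by exists (A i).
exists (~` \bigcup_(j in [set j | j <> i]) A j).
  by apply: open_closedC; apply: bigcup_open => j _; exact: oA.
apply/seteqP; split => a /= [Ca H]; split => //.
  by move=> [j /= ji Aja]; apply: ji; exact: dA Aja H.
have [j Aja] := CA _ Ca.
have [<-//|ji] := pselect (j = i).
by exfalso; apply: H; exists j.
Qed.

(** Each half of a small punctured ball is connected, so it lies in one piece. Two pieces then fill
    the punctured ball, and a third cannot accumulate at [t]. *)
Lemma real_not_splits3 (R : realType) (t : R) :
  ~ splits (option (option unit)) t.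
Proof.
move=> [A [oA nA dA clA]] /nbhs_ballP[e /= e0 teA].
have piece (a b : R) : (a < b)%R -> `]a, b[ `<=` ball t e -> ~ `]a, b[ t ->
    exists i, `]a, b[ `<=` A i.
  move=> ab abe abt; apply: connected_sub_piece => //.
  - apply/connected_intervalP => x y /= xa yb z /andP[xz zy].
    move: xa yb; rewrite !in_itv /= => /andP[ax _] /andP[_ yb].
    by rewrite (lt_le_trans ax xz) (le_lt_trans zy yb).
  - by exists ((a + b) / 2)%R; rewrite /= in_itv /= !midf_lt.
  - by move=> x abx; have [xt|//] := teA _ (abe _ abx); case: abt; rewrite -xt.
have [|||i tl] := piece (t - e)%R t.
- by rewrite ltrBlDr ltrDl.
- move=> x /=; rewrite in_itv /= => /andP[x1 x2].
  by rewrite /ball /= gtr0_norm ?subr_gt0// ltrBlDr addrC -ltrBlDr.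
- by rewrite /= in_itv /= ltxx andbF.
have [|||j tr] := piece t (t + e)%R.
- by rewrite ltrDl.
- move=> x /=; rewrite in_itv /= => /andP[x1 x2].
  by rewrite /ball /= ltr0_norm ?subr_lt0// opprB ltrBlDr addrC.
- by rewrite /= in_itv /= ltxx.
have [k [ki kj]] : exists k, k <> i /\ k <> j.
  have n0 : None <> Some (Some tt) by [].
  case: i {tl} => [[[]|]|]; case: j {tr} => [[[]|]|];
    by [exists None | exists (Some None) | exists (Some (Some tt))].
have [x [Akx /ball_sym]] := clA k _ (nbhsx_ballx t e e0).
rewrite /ball /= ltr_distl => /andP[x1 x2].
have [xt|tx|xt] := ltgtP x t.
- by apply: ki; apply: dA Akx _; apply: tl; rewrite /= in_itv /= x1.
- by apply: kj; apply: dA Akx _; apply: tr; rewrite /= in_itv /= tx.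
- by apply: (nA k); rewrite -xt.
Qed.

(** * Separation and compactness read off from cards *)

Lemma open_setC1 (T : topologicalType) {x : T} :
  hausdorff_space T -> open (~` [set x]).
Proof.
move=> hT; apply: closed_openC; apply: accessible_closed_set1.
exact: hausdorff_accessible.
Qed.

Lemma set_type_hausdorff (T : topologicalType) (A : set T) :
  hausdorff_space T -> hausdorff_space (set_type A).
Proof.
move=> hT u v uv; apply: val_inj; apply: hT => P Q Pu Qv.
have cval : continuous (set_val : set_type A -> T) by exact: initial_continuous.
have [w [Pw Qw]] := uv _ _ (cval _ _ Pu) (cval _ _ Qv).
by exists (set_val w).
Qed.

Lemma infinite_set_notin (T : eqType) (s : seq T) :
  infinite_set [set: T] -> exists x, x \notin s.
Proof.
move=> iT; apply: contrapT => /forallNP sT; apply: iT.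
apply: (@sub_finite_set _ _ [set` s]) => // x _ /=.
by apply: contrapT => /negP; exact: sT.
Qed.

Lemma card_infinite (X Y : topologicalType) (x : X) (y : Y) :
  homeomorphic (set_type (~` [set x])) (set_type (~` [set y])) ->
  infinite_set [set: X] -> infinite_set [set: Y].
Proof.
move=> /(homeomorphic_rel x y)[f [g [[fK _ _ _] _ _]]] iX fY; apply: iX.
apply: (@sub_finite_set _ _ ([set x] `|` g @` [set: Y])).
  move=> a _; have [->|ax] := pselect (a = x); first by left.
  by right; exists (f a) => //; have [] := fK _ ax.
by rewrite finite_setU; split => //; exact: finite_image.
Qed.

(* The card at [w] separates two points up to [w]; two choices of [w] separate
   them outright. *)
Lemma cards_hausdorff (Y : topologicalType) :
  infinite_set [set: Y] ->
  (forall y : Y, hausdorff_space (set_type (~` [set y]))) -> hausdorff_space Y.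
Proof.
move=> iY hY p q pq; apply: contrapT => npq.
have sep w : w != p -> w != q ->
    exists P Q, [/\ nbhs p P, nbhs q Q & P `&` Q `<=` [set w]].
  move=> wp wq.
  have pw : p \in ~` [set w] by apply: mem_set => /= E; rewrite E eqxx in wp.
  have qw : q \in ~` [set w] by apply: mem_set => /= E; rewrite E eqxx in wq.
  have := hY w; rewrite open_hausdorff => /(_ (SigSub pw) (SigSub qw)).
  case.
    by apply/eqP => /(congr1 set_val).
  move=> [P0 Q0] /= [/set_mem Pp /set_mem Qq] [[P oP PE] [Q oQ QE] /eqP PQ].
  subst P0 Q0.
  exists P, Q; split; [exact: open_nbhs_nbhs|exact: open_nbhs_nbhs|].
  move=> a [Pa Qa]; apply: contrapT => naw.
  have aw : a \in ~` [set w] by exact: mem_set.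
  suff : set0 (SigSub aw : set_type (~` [set w])) by [].
  by rewrite -PQ.
have [w] := infinite_set_notin [:: p; q] iY.
rewrite !inE negb_or => /andP[wp wq].
have [w'] := infinite_set_notin [:: p; q; w] iY.
rewrite !inE !negb_or => /and3P[wp' wq' ww'].
have [P [Q [Pp Qq PQ]]] := sep _ wp wq.
have [P' [Q' [Pp' Qq' PQ']]] := sep _ wp' wq'.
have [a [[Pa Pa'] [Qa Qa']]] := pq _ _ (filterI Pp Pp') (filterI Qq Qq').
move: ww'; rewrite -(PQ a (conj Pa Qa)) -(PQ' a (conj Pa' Qa')).
by rewrite eqxx.
Qed.

(** Disjoint open sets around [g y] and [x] give a compact neighborhood of [g y] that avoids [x],
    and [f] carries it into [Y]. *)
Lemma cards_compact_nbhs (X Y : topologicalType) (x : X) (w y : Y) :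
  compact [set: X] -> hausdorff_space X -> hausdorff_space Y ->
  homeomorphic (set_type (~` [set x])) (set_type (~` [set w])) -> y <> w ->
  exists2 K, compact K & nbhs y K.
Proof.
move=> cX hX hY /(homeomorphic_rel x w)[f [g [fg _ _]]] yw.
have [fK gK _ _] := fg.
have [gyx fgy] := gK _ yw.
have /eqP gyx' := gyx.
have := hX; rewrite open_hausdorff => /(_ _ _ gyx').
case=> -[U V] /= [/set_mem Uy /set_mem Vx] [oU oV /eqP UV].
exists (f @` (~` V)).
  apply: (rel_homeo_compact (open_setC1 hX) fg) => [|a Va /= ax].
    by apply: (subclosed_compact _ cX) => //; exact: open_closedC.
  by apply: Va; rewrite ax.
have nV : nbhs (g y) (~` V).
  apply: (@filterS _ (nbhs (g y)) _ U); last exact: open_nbhs_nbhs.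
  by move=> a Ua Va; suff : set0 a by []; rewrite -UV.
have ng : nbhs y (g @^-1` (~` V)).
  exact: (rel_homeo_continuous (open_setC1 hY) (rel_homeo_sym fg) yw).
have nw : nbhs y (~` [set w]).
  by apply: open_nbhs_nbhs; split => //; exact: open_setC1.
apply: (@filterS _ (nbhs y) _ (g @^-1` (~` V) `&` ~` [set w])).
  2: exact: filterI.
by move=> b [Vb bw]; exists (g b) => //; have [] := gK _ bw.
Qed.

Lemma card_compact (X Y : topologicalType) (x : X) (y : Y) :
  hausdorff_space X -> compact (~` [set x]) ->
  homeomorphic (set_type (~` [set x])) (set_type (~` [set y])) ->
  compact [set: Y].
Proof.
move=> hX cx /(homeomorphic_rel x y)[f [g [fg _ _]]].
have [fK gK _ _] := fg.
have cf := rel_homeo_compact (open_setC1 hX) fg cx (@subset_refl _ _).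
rewrite (_ : [set: Y] = f @` (~` [set x]) `|` [set y]).
  by apply: compactU => //; exact: compact_set1.
apply/seteqP; split => // b _.
have [->|b_y] := pselect (b = y); first by right.
by left; have [gbx fgb] := gK _ b_y; exists (g b).
Qed.

(** Uniqueness of the one-point compactification: the open neighborhoods of the added point are the
    complements of the compact subsets of the card. *)
Lemma compact_eq_of_card (X Y : topologicalType) (x : X) (y : Y) :
  hausdorff_space X -> hausdorff_space Y ->
  compact [set: X] -> compact [set: Y] ->
  homeomorphic (set_type (~` [set x])) (set_type (~` [set y])) ->
  homeomorphic X Y.
Proof.
move=> hX hY cX cY /(homeomorphic_rel x y)[f [g [fg fx gy]]].
have ext (S T : topologicalType) (s : S) (t : T) h k :
    hausdorff_space S -> hausdorff_space T -> compact [set: T] ->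
    rel_homeo (~` [set s]) (~` [set t]) h k -> h s = t ->
    continuous h.
  move=> hS hT cT hk hs a.
  have [->|ax] := pselect (a = s); last first.
    exact: (rel_homeo_continuous (open_setC1 hS) hk).
  move=> N; rewrite hs nbhsE => -[U [oU Ut] UN].
  have cC : compact (k @` (~` U)).
    apply: (rel_homeo_compact (open_setC1 hT) (rel_homeo_sym hk)).
      by apply: (subclosed_compact _ cT) => //; exact: open_closedC.
    by move=> b Ub /= bt; apply: Ub; rewrite bt.
  have [hK kK _ _] := hk.
  apply: (@filterS _ (nbhs s) _ (~` (k @` (~` U)))).
    move=> c nc; apply: UN; apply: contrapT => nU.
    have [cs|cs] := pselect (c = s); first by apply: nU; rewrite cs hs.
    by apply: nc; exists (h c) => //; have [] := hK _ cs.
  apply: open_nbhs_nbhs; split.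
    by apply: closed_openC; exact: compact_closed.
  move=> [b Ub kb]; have [bt|bt] := pselect (b = t).
    by apply: Ub; rewrite bt.
  by have [] := kK _ bt.
have fx' : f x = y by apply: fx; apply.
have gy' : g y = x by apply: gy; apply.
have [fK gK _ _] := fg.
exists f, g; split.
- by move=> a; have [->|/fK[]//] := pselect (a = x); rewrite fx'.
- by move=> a; have [->|/gK[]//] := pselect (a = y); rewrite gy'.
- exact: (ext _ _ _ _ _ _ hX hY cY fg).
- exact: (ext _ _ _ _ _ _ hY hX cX (rel_homeo_sym fg)).
Qed.

(** * Local ends and the end at infinity *)

Lemma not_isolated_splits (T : topologicalType) (x : T) :
  hausdorff_space T -> ~ open [set x] -> splits unit x.
Proof.
move=> hT nx; exists (fun _ => ~` [set x]); split.
- by move=> _; exact: open_setC1.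
- by move=> _; apply.
- by move=> [] [].
- move=> _ N Nx; apply: contrapT => noC; apply: nx.
  rewrite openE => _ ->; apply: filterS Nx => a Na.
  by apply: contrapT => ax; apply: noC; exists a.
- apply: filterS filterT => a _; have [->|ax] := pselect (a = x); first by left.
  by right; exists tt.
Qed.

(* The extra piece [None] is the end of [Y] at infinity, that is, [~` K]. *)
Lemma card_splits (I : Type) (X Y : topologicalType) (x : X) (y : Y) K :
  hausdorff_space X -> hausdorff_space Y ->
  compact [set: X] -> ~ compact [set: Y] ->
  homeomorphic (set_type (~` [set x])) (set_type (~` [set y])) ->
  compact K -> nbhs y K -> splits I y -> splits (option I) x.
Proof.
move=> hX hY cX ncY /(homeomorphic_rel x y)[f [g [fg _ _]]] cK Ky.
move=> [A [oA nA dA clA NA]].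
have gf := rel_homeo_sym fg.
have [fK gK _ _] := fg.
have oX := open_setC1 (x := x) hX.
have oY := open_setC1 (x := y) hY.
have yK : K° y := Ky.
have clK : closed K by exact: compact_closed.
pose P i := if i is Some i then K° `&` A i else ~` K.
have oP i : open (P i).
  by case: i => [i|]; [apply: openI => //; exact: open_interior | exact: closed_openC].
have Py i : ~ P i y.
  by case: i => [i [_ /nA]//|]; apply; exact: interior_subset.
exists (fun i => ~` [set x] `&` f @^-1` (P i)); split.
- by move=> i; exact: (rel_homeo_open oX fg).
- by move=> i [+ _]; apply.
- move=> i j a [_ /= Pi] [_ /= Pj]; case: i j Pi Pj => [i|] [j|] //=.
  + by move=> [_ Ai] [_ Aj]; rewrite (dA _ _ _ Ai Aj).
  + by move=> [/interior_subset Ka _] /(_ Ka).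
  + by move=> + [/interior_subset Ka _]; move=> /(_ Ka).
(* The part of the card outside [U] corresponds to a compact set in [Y] missing [y]. It suffices
   that [P i] is not contained in that set. *)
- move=> i N; rewrite nbhsE => -[U [oU Ux] UN].
  have cC : compact (f @` (~` U)).
    apply: (rel_homeo_compact oX fg).
      by apply: (subclosed_compact _ cX) => //; exact: open_closedC.
    by move=> a Ua /= ax; apply: Ua; rewrite ax.
  have yC : ~ (f @` (~` U)) y.
    move=> [a Ua fa]; have [ax|ax] := pselect (a = x).
      by apply: Ua; rewrite ax.
    by have [] := fK _ ax.
  suff [b [Pb nCb]] : exists b, P i b /\ ~ (f @` (~` U)) b.
    have b_y : b <> y by move=> E; apply: (Py i); rewrite -E.
    have [gbx fgb] := gK _ b_y.
    exists (g b); split; first by split => //=; rewrite fgb.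
    by apply: UN; apply: contrapT => nU; apply: nCb; exists (g b).
  case: i => [i|] /=.
    have [|b [Ab [Cb Kb]]] := clA i (~` (f @` (~` U)) `&` K°).
      apply: filterI; last exact: nbhs_interior.
      apply: open_nbhs_nbhs; split => //; apply: closed_openC.
      exact: compact_closed.
    by exists b.
  apply: contrapT => nb; apply: ncY.
  rewrite (_ : [set: Y] = K `|` f @` (~` U)); first exact: compactU.
  apply/seteqP; split => // b _; apply: contrapT => nKb; apply: nb; exists b.
  by split => H; apply: nKb; [left | right].
(* What the pieces miss in [Y] besides [y] lies in a compact subset of [K] avoiding [y]; its image
   under [g] is closed and avoids [x]. *)
- pose W := [set b | b = y \/ exists i, A i b].
  have cC : compact (g @` (K `\` (K° `&` W°))).
    apply: (rel_homeo_compact oY gf).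
      apply: (subclosed_compact _ cK) => //.
      apply: closedI => //; apply: open_closedC.
      by apply: openI; exact: open_interior.
    by move=> b [_ nb] /= b_y; apply: nb; rewrite b_y.
  apply: (@filterS _ (nbhs x) _ (~` (g @` (K `\` (K° `&` W°))))).
    move=> a nC; have [->|ax] := pselect (a = x); [by left | right].
    have [fay gfa] := fK _ ax.
    have [Kfa|nKfa] := pselect (K (f a)); last by exists None; split.
    have [[Kf Wo]|nKW] := pselect ((K° `&` W°) (f a)).
      have Wf : W (f a) by exact: interior_subset.
      case: Wf => [/fay//|[i Ai]].
      by exists (Some i); split.
    by exfalso; apply: nC; exists (f a).
  apply: open_nbhs_nbhs; split.
    by apply: closed_openC; exact: compact_closed.
  move=> [b [_ nKW] gb]; have [b_y|b_y] := pselect (b = y).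
    by apply: nKW; rewrite b_y.
  by have [] := gK _ b_y.
Qed.

(** * From equal decks to a homeomorphism *)

Lemma deck_eq_card (X Y : topologicalType) (y : Y) :
  deck Y = deck X ->
  exists x : X,
    homeomorphic (set_type (~` [set x])) (set_type (~` [set y])).
Proof.
move=> YX; have : deck Y (homeo_class (set_type (~` [set y]))) by exists y.
rewrite YX => -[x E]; exists x.
have : homeo_class (set_type (~` [set y])) (set_type (~` [set y])).
  exact: homeomorphic_refl.
by rewrite E.
Qed.

Theorem corollary5p1 (R : realType) (X : topologicalType) (V : set X)
    (X_three_points : `I_3 #<= [set: X])
    (X_compact : compact [set: X])
    (XV_graph_like : graph_like R V)
    (X_has_edge : edges V !=set0) :
  reconstructible X.
Proof.
move=> Y YX.
have [[M XM] _ edgeP] := XV_graph_like.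
have hX : hausdorff_space X.
  exact: (homeomorphic_hausdorff XM (@metric_hausdorff _ M)).
have [e eV] := X_has_edge; have [oe eI _] := edgeP _ eV.
have [x0 ex0] : e !=set0.
  case: eV => x0 nVx0 <-; exists x0.
  by apply: connected_component_refl; exact: nVx0.
have [p [q [pq _ _]]] := homeomorphic_rel x0 (0 : R)%R eI.
have oI : open (`]0%R, 1%R[ : set R) by apply: interval_open.
have [pK qK _ _] := pq.
have iX : infinite_set [set: X].
  move=> fX; have : infinite_set (`]0%R, 1%R[ : set R).
    move=> fI; apply: infinite_nat.
    (* The interval contains every [1 / (n + 2)]; the shift by two keeps these reciprocals strictly
       below 1. *)
    apply: (@sub_finite_set _ _ ((fun n => n.+2%:R^-1 : R)%R @^-1` `]0%R, 1%R[)).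
      by move=> n _; rewrite /= in_itv /= invr_gt0 ltr0n invf_lt1 ?ltr1n ?ltr0n.
    apply: finite_preimage fI => m n _ _ /invr_inj/eqP.
    by rewrite eqr_nat => /eqP[].
  apply; apply: (@sub_finite_set _ _ (p @` [set: X])); last exact: finite_image.
  by move=> t /qK[_ <-]; exists (q t).
have x0_no3 : ~ splits (option (option unit)) x0.
  by move=> /(rel_homeo_splits oe oI pq ex0); exact: real_not_splits3.
have cardX y := deck_eq_card y YX.
have cardY x := deck_eq_card x (esym YX).
have iY : infinite_set [set: Y].
  have [y yx] := cardY x0.
  exact: card_infinite (homeomorphic_sym yx) iX.
have hY : hausdorff_space Y.
  apply: cards_hausdorff => // y; have [x xy] := cardX y.
  apply: (homeomorphic_hausdorff (homeomorphic_sym xy)).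
  exact: set_type_hausdorff.
have other (y : Y) : exists w, y <> w.
  have [w] := infinite_set_notin [:: y] iY.
  by rewrite inE => /eqP wy; exists w => yw; apply: wy.
have [y0 /homeomorphic_sym xy0] := cardY x0.
have [cY|ncY] := pselect (compact [set: Y]).
  by apply: homeomorphic_sym; exact: (compact_eq_of_card hX hY _ _ xy0).
exfalso.
have locY (y : Y) : exists2 K, compact K & nbhs y K.
  have [w yw] := other y; have [x xw] := cardX w.
  exact: (cards_compact_nbhs X_compact hX hY xw yw).
have splitY (y : Y) : splits unit y.
  apply: not_isolated_splits => // oy.
  have [w yw] := other y; have [x xw] := cardX w.
  have [f [g [fg _ _]]] := homeomorphic_rel x w xw.
  have [fK gK _ _] := fg.
  have [gyx fgy] := gK _ yw.
  (* An isolated [y] makes [g y] isolated in [X]. Removing [g y] then leaves a closed, hence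
     compact, set, and the matching card of [Y] forces [Y] to be compact. *)
  have ogy : open [set g y].
    rewrite (_ : [set g y] = ~` [set x] `&` f @^-1` [set y]).
      exact: (rel_homeo_open (open_setC1 hX) fg).
    apply/seteqP; split => a /=; first by move=> ->.
    by move=> [ax <-]; have [_ ->] := fK _ ax.
  have [z zgy] := cardY (g y).
  apply: ncY; apply: (card_compact hX _ (homeomorphic_sym zgy)).
  by apply: (subclosed_compact _ X_compact) => //; exact: open_closedC.
have splitX (x : X) : splits (option unit) x.
  have [y /homeomorphic_sym xy] := cardY x; have [K cK Ky] := locY y.
  exact: (card_splits hX hY X_compact ncY xy cK Ky).
have y0_no2 : ~ splits (option unit) y0.
  have [K cK Ky] := locY y0 => sy0; apply: x0_no3.
  exact: (card_splits hX hY X_compact ncY xy0 cK Ky).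
(* In the card of [Y] at [w], the point [y0] corresponds to [g y0] in [X], whose two local ends are
   carried back by [f]. *)
have [w y0w] := other y0; have [x xw] := cardX w.
have [f [g [fg _ _]]] := homeomorphic_rel x w xw.
have [_ gK _ _] := fg; have [gyx fgy] := gK _ y0w.
apply: y0_no2; rewrite -fgy.
exact: (rel_homeo_splits (open_setC1 hX) (open_setC1 hY) fg gyx).
Qed.
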